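(* For every $d\in\{1,\dots,D\}$, the points $(\beta^*_{a\cup\{d\}},\alpha^*_{a\cup\{d\}})$ and constants $\boldsymbol c^*_{a\cup\{d\}}$, $a\subset\{1,2,\dots,d-1\}$, solve the harmonic system defined by $G_d$.
   Context: Let $D\ge2$ and let $\lambda,\mu_1,\dots,\mu_D>0$ with $\lambda+\sum_j\mu_j=1$, $\lambda<\mu_j$ for all $j$, and $\mu_i\ne\mu_j$ for $i\ne j$. Put $\rho_j=\lambda/\mu_j$, $\mathcal N=\{2,\dots,D\}$. For $\beta\in\mathbb{C}\setminus\{0\}$ and $\alpha=(\alpha(2),\dots,\alpha(D))\in(\mathbb{C}\setminus\{0\})^{\mathcal N}$, with the convention $\alpha(D+1)=\beta$, let $\mathbf p(\beta,\alpha)=\lambda\frac1\beta+\mu_1\alpha(2)+\sum_{j=2}^D\mu_j\frac{\alpha(j+1)}{\alpha(j)}$ and, for $l\in\mathcal N$, $\mathbf p_l(\beta,\alpha)=\lambda\frac1\beta+\mu_1\alpha(2)+\mu_l+\sum_{j=2,j\ne l}^D\mu_j\frac{\alpha(j+1)}{\alpha(j)}$. Let $\mathcal H=\{\mathbf p=1\}$, $\mathcal H_l=\{\mathbf p_l=1\}$, $C(l,\beta,\alpha)=\mu_l-\mu_l\frac{\alpha(l+1)}{\alpha(l)}$. Two distinct points $(\beta,\alpha),(\beta,\alpha')\in\mathcal H$ are $l$-conjugate ($l\in\mathcal N$) if $\alpha,\alpha'$ agree on $\mathcal N\setminus\{l\}$ and $\alpha'(l)=\frac1{\alpha(2)}\frac{\alpha(3)\mu_2}{\mu_1}$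 when $l=2$, $\alpha'(l)=\frac1{\alpha(l)}\frac{\alpha(l-1)\alpha(l+1)\mu_l}{\mu_{l-1}}$ when $2<l\le D$. A labeled graph $G$ has a finite vertex set $V_G$ and is symmetric: for $i\ne j$, $G(i,j)=G(j,i)$ is $0$ if $i,j$ are not connected and is $l\in\mathcal N$ if connected by an edge with label $l$; $G(j,j)\subset\mathcal N$ is the set of labels of the loops at $j$. It is edge-complete if for each vertex and each $l\in\mathcal N$ there is exactly one edge with label $l$ at that vertex (possibly a loop). The harmonic system defined by an edge-complete $G$ has unknowns $\beta$, $\alpha_j$, $\boldsymbol c_j$, $j\in V_G$ ($\beta$ common to all vertices), and constraints: (1) $(\beta,\alpha_j)\in\mathcal H$, $\boldsymbol c_j\in\mathbb{C}\setminus\{0\}$; (2) $\alpha_i\ne\alpha_j$ for $i\ne j$; (3) $(\beta,\alpha_i),(\beta,\alpha_j)$ are $G(i,j)$-conjugate if $i\neq j$, $G(i,j)\ne0$; (4) $\boldsymbol c_i/\boldsymbol c_j=-C(G(i,j),\beta,\alpha_j)/C(G(i,j),\beta,\alpha_i)$ if $i\ne j$, $G(i,j)\ne0$; (5) $(\beta,\alpha_j)\in\mathcal H_l$ for all $l\in G(j,j)$, $j\in V_G$. For $d\in\{1,\dots,D\}$ the graph $G_d$ has vertices $a\cup\{d\}$, $a\subset\{1,\dots,d-1\}$; for $j\in(a\cup\{d\})\cap\mathcal N$ with $j-1\notin a$ there is an edge with label $j$ between $a\cup\{d\}$ and $a\cup\{d\}\cup\{j-1\}$; the loops are $G_d(a\cup\{d\},a\cup\{d\})=\mathcal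 N\setminus(a\cup\{d\})$; there are no other edges. For a nonempty $a\subset\{1,\dots,D\}$ with elements $a(1)<\dots<a(|a|)$: $\boldsymbol c_a^*=(-1)^{|a|-1}\prod_{j=1}^{|a|-1}\prod_{l=a(j)+1}^{a(j+1)}\frac{\mu_l-\lambda}{\mu_l-\mu_{a(j)}}$; for $l\in\mathcal N$, $\alpha_a^*(l)=1$ if $l\le a(1)$, $\alpha_a^*(l)=\rho_{a(j)}$ if $a(j)<l\le a(j+1)$, $\alpha_a^*(l)=\rho_{a(|a|)}$ if $l>a(|a|)$; and $\beta_a^*=\rho_{a(|a|)}$. *)

(* Defs.v *)
From HB Require Import structures.
From mathcomp Require Import all_boot all_order all_algebra.
From mathcomp Require Import reals.
From mathcomp Require Import complex.

Set Implicit Arguments.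
Unset Strict Implicit.
Unset Printing Implicit Defensive.

Import Order.TTheory GRing.Theory Num.Theory.
Local Open Scope ring_scope.
Local Open Scope complex_scope.

(* The index set N = {2, ..., D}. *)
Record label (D : nat) := Label {
  label_ord :> 'I_D.+1;
  label_gt1 : (1 < label_ord)%N
}.

HB.instance Definition _ (D : nat) := [isSub for @label_ord D].
HB.instance Definition _ (D : nat) := [Finite of label D by <:].

(* Only the values mu 1, ..., mu D are ever used. *)
Definition rho (R : realType) (lambda : R) (mu : nat -> R) (j : nat) : R :=
  lambda / mu j.

(* alpha(k) for k in {2, ..., D}, with the convention alpha(D+1) = beta;
   only evaluated at k in {2, ..., D+1}. *)
Definition coord (R : realType) (D : nat) (beta : R[i])
    (alpha : {ffun label D -> R[i]}) (k : nat) : R[i] :=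
  if [pick l : label D | l == k :> nat] is Some l then alpha l else beta.

Definition charp (R : realType) (D : nat) (lambda : R) (mu : nat -> R)
    (beta : R[i]) (alpha : {ffun label D -> R[i]}) : R[i] :=
  lambda%:C * beta^-1 + (mu 1)%:C * coord beta alpha 2
  + \sum_(j : label D) (mu j)%:C * (coord beta alpha j.+1 / alpha j).

Definition charp_l (R : realType) (D : nat) (lambda : R) (mu : nat -> R)
    (l : label D) (beta : R[i]) (alpha : {ffun label D -> R[i]}) : R[i] :=
  lambda%:C * beta^-1 + (mu 1)%:C * coord beta alpha 2 + (mu l)%:C
  + \sum_(j : label D | j != l) (mu j)%:C * (coord beta alpha j.+1 / alpha j).

(* (beta, alpha) ranges over (C \ {0}) x (C \ {0})^N. *)
Definition nonzero_pt (R : realType) (D : nat) (beta : R[i])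
    (alpha : {ffun label D -> R[i]}) : Prop :=
  beta != 0 /\ forall l : label D, alpha l != 0.

Definition inH (R : realType) (D : nat) (lambda : R) (mu : nat -> R)
    (beta : R[i]) (alpha : {ffun label D -> R[i]}) : Prop :=
  nonzero_pt beta alpha /\ charp lambda mu beta alpha = 1.

Definition inH_l (R : realType) (D : nat) (lambda : R) (mu : nat -> R)
    (l : label D) (beta : R[i]) (alpha : {ffun label D -> R[i]}) : Prop :=
  nonzero_pt beta alpha /\ charp_l lambda mu l beta alpha = 1.

Definition Ccoef (R : realType) (D : nat) (mu : nat -> R)
    (l : label D) (beta : R[i]) (alpha : {ffun label D -> R[i]}) : R[i] :=
  (mu l)%:C - (mu l)%:C * (coord beta alpha l.+1 / alpha l).

Definition conjugate_value (R : realType) (D : nat) (mu : nat -> R)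
    (l : label D) (beta : R[i]) (alpha : {ffun label D -> R[i]}) : R[i] :=
  if (l == 2 :> nat) then
    (coord beta alpha 2)^-1 * (coord beta alpha 3 * (mu 2)%:C / (mu 1)%:C)
  else
    (alpha l)^-1 * (coord beta alpha l.-1 * coord beta alpha l.+1 * (mu l)%:C
                    / (mu l.-1)%:C).

Definition conjugate (R : realType) (D : nat) (lambda : R) (mu : nat -> R)
    (l : label D) (beta : R[i]) (alpha alpha' : {ffun label D -> R[i]}) : Prop :=
  [/\ inH lambda mu beta alpha, inH lambda mu beta alpha', alpha <> alpha',
      (forall k : label D, k != l -> alpha' k = alpha k)
    & alpha' l = conjugate_value mu l beta alpha].

(* The symmetric matrix G of the labeled graph is split into [edge] (off the
   diagonal; [None] encodes the value 0) and [loops] (on the diagonal); the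
   values [edge i i] carry no information. *)
Record labeled_graph (D : nat) := LabeledGraph {
  vertex :> finType;
  edge : vertex -> vertex -> option (label D);
  loops : vertex -> {set label D};
  edge_sym : forall i j, i != j -> edge i j = edge j i
}.

Definition edge_complete (D : nat) (G : labeled_graph D) : Prop :=
  forall (i : G) (l : label D),
    (#|[set j : G | (j != i) && (edge i j == Some l)]| + (l \in loops i))%N = 1%N.

Record edge_complete_graph (D : nat) := EdgeCompleteGraph {
  ec_graph :> labeled_graph D;
  ec_graphP : edge_complete ec_graph
}.

Definition solves_harmonic_system (R : realType) (D : nat)
    (lambda : R) (mu : nat -> R) (G : edge_complete_graph D)
    (beta : R[i]) (alpha : G -> {ffun label D -> R[i]}) (c : G -> R[i]) : Prop :=
  [/\ (forall j : G, inH lambda mu beta (alpha j) /\ c j != 0),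
      (forall i j : G, i != j -> alpha i <> alpha j),
      (forall (i j : G) (l : label D), i != j -> edge i j = Some l ->
         conjugate lambda mu l beta (alpha i) (alpha j)),
      (forall (i j : G) (l : label D), i != j -> edge i j = Some l ->
         c i / c j = - (Ccoef mu l beta (alpha j) / Ccoef mu l beta (alpha i)))
    & (forall (j : G) (l : label D), l \in loops j ->
         inH_l lambda mu l beta (alpha j))].

(* The vertex a \cup {d} of G_d is represented by its part
   a \subset {1, ..., d-1}. *)
Record Gd_vertex (D : nat) (d : 'I_D.+1) := GdVertex {
  Gd_base : {set 'I_D.+1};
  Gd_baseP : Gd_base \subset [set k : 'I_D.+1 | (0 < k < d)%N]
}.

HB.instance Definition _ (D : nat) (d : 'I_D.+1) := [isSub for @Gd_base D d].
HB.instance Definition _ (D : nat) (d : 'I_D.+1) :=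
  [Finite of Gd_vertex d by <:].

Definition Gd_set (D : nat) (d : 'I_D.+1) (a : Gd_vertex d) : {set 'I_D.+1} :=
  d |: Gd_base a.

Definition label_pred (D : nat) (l : label D) : 'I_D.+1 := inord l.-1.

Definition Gd_step (D : nat) (d : 'I_D.+1) (a b : Gd_vertex d) (j : label D) :
    bool :=
  [&& label_ord j \in Gd_set a, label_pred j \notin Gd_base a
    & Gd_set b == Gd_set a :|: [set label_pred j]].

(* At most one label satisfies the condition under [pick]: see [Gd_edgeP]. *)
Definition Gd_edge (D : nat) (d : 'I_D.+1) (a b : Gd_vertex d) :
    option (label D) :=
  [pick j : label D | Gd_step a b j || Gd_step b a j].

Definition Gd_loops (D : nat) (d : 'I_D.+1) (a : Gd_vertex d) :
    {set label D} :=
  [set l : label D | label_ord l \notin Gd_set a].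

Lemma Gd_edge_sym (D : nat) (d : 'I_D.+1) (a b : Gd_vertex d) :
  a != b -> Gd_edge a b = Gd_edge b a.
Proof. by move=> _; apply: eq_pick => j /=; rewrite orbC. Qed.

Definition Gd_graph (D : nat) (d : 'I_D.+1) : labeled_graph D :=
  LabeledGraph (@Gd_loops D d) (@Gd_edge_sym D d).

Lemma label_predE (D : nat) (l : label D) : label_pred l = l.-1 :> nat.
Proof. by rewrite inordK // (leq_ltn_trans (leq_pred _) (ltn_ord l)). Qed.

Lemma label_pred_inj (D : nat) : injective (@label_pred D).
Proof.
move=> l l' /(congr1 val) /=; rewrite !label_predE => e.
apply/val_inj/val_inj => /=.
by rewrite -(ltn_predK (label_gt1 l)) e (ltn_predK (label_gt1 l')).
Qed.

Lemma Gd_baseE (D : nat) (d : 'I_D.+1) (a : Gd_vertex d) (k : 'I_D.+1) :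
  k \in Gd_base a -> (0 < k < d)%N.
Proof. by move/(subsetP (Gd_baseP a)); rewrite inE. Qed.

Lemma Gd_setE (D : nat) (d : 'I_D.+1) (a : Gd_vertex d) :
  Gd_base a = Gd_set a :\ d.
Proof.
rewrite /Gd_set setU1K //; apply/negP => /Gd_baseE.
by rewrite ltnn andbF.
Qed.

Lemma Gd_set_inj (D : nat) (d : 'I_D.+1) : injective (@Gd_set D d).
Proof. by move=> a b e; apply/val_inj; rewrite /= !Gd_setE e. Qed.

Lemma label_pred_lt (D : nat) (d : 'I_D.+1) (a : Gd_vertex d) (l : label D) :
  label_ord l \in Gd_set a -> (0 < label_pred l < d)%N.
Proof.
move=> h; rewrite label_predE; have l1 := label_gt1 l.
have ld : (l <= d)%N.
  by case/setU1P: h => [-> //|/Gd_baseE /andP[_ /ltnW]].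
by rewrite -ltnS (ltn_predK l1) l1 /= (leq_trans _ ld) // (ltn_predK l1).
Qed.

Lemma label_pred_set (D : nat) (d : 'I_D.+1) (a : Gd_vertex d) (l : label D) :
  label_ord l \in Gd_set a ->
  (label_pred l \in Gd_set a) = (label_pred l \in Gd_base a).
Proof.
move=> /label_pred_lt /andP[_ lt]; rewrite in_setU1; case: eqP => // e.
by rewrite e ltnn in lt.
Qed.

Lemma Gd_stepP (D : nat) (d : 'I_D.+1) (a b : Gd_vertex d) (l : label D) :
  Gd_step a b l -> label_pred l \notin Gd_set a /\ label_pred l \in Gd_set b.
Proof.
case/and3P=> la pa /eqP eb; split; first by rewrite label_pred_set.
by rewrite eb !inE eqxx orbT.
Qed.

Lemma Gd_step_uniq (D : nat) (d : 'I_D.+1) (a b : Gd_vertex d)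
    (l l' : label D) :
  Gd_step a b l -> Gd_step a b l' || Gd_step b a l' -> l' = l.
Proof.
move=> h; case/orP => h'.
  have [na] := Gd_stepP h'; case/and3P: h => _ _ /eqP ->.
  by rewrite in_setU (negPf na) in_set1 => /eqP /label_pred_inj.
case/and3P: h' => _ _ /eqP ea; have [na nb] := Gd_stepP h.
by rewrite ea in_setU nb in na.
Qed.

Lemma Gd_edgeP (D : nat) (d : 'I_D.+1) (a b : Gd_vertex d) (l : label D) :
  (Gd_edge a b == Some l) = Gd_step a b l || Gd_step b a l.
Proof.
rewrite /Gd_edge; case: pickP => [l' h'|-> //].
apply/eqP/idP => [[<-] //|h]; congr Some.
case/orP: h => h; first exact: Gd_step_uniq h h'.
by rewrite orbC in h'; exact: Gd_step_uniq h h'.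
Qed.

Lemma Gd_edge_complete (D : nat) (d : 'I_D.+1) : edge_complete (Gd_graph d).
Proof.
move=> a l /=; rewrite inE.
have [la|la] /= := boolP (label_ord l \in Gd_set a); last first.
  rewrite addn1; congr S; apply/eqP; rewrite cards_eq0; apply/eqP/setP => b.
  rewrite !inE Gd_edgeP /Gd_step (negPf la) /=; apply/negbTE/negP.
  case/and4P=> _ lb _ /eqP ea.
  by move: la; rewrite ea in_setU lb.
rewrite addn0.
have sub0 : label_pred l |: Gd_base a \subset [set k : 'I_D.+1 | (0 < k < d)%N].
  by rewrite subUset Gd_baseP andbT sub1set inE (label_pred_lt la).
have sub1 : Gd_base a :\ label_pred l \subset [set k : 'I_D.+1 | (0 < k < d)%N].
  exact: subset_trans (subsetDl _ _) (Gd_baseP a).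
have [pa|pa] := boolP (label_pred l \in Gd_base a).
  pose b0 := GdVertex sub1.
  have lp : label_ord l != label_pred l.
    rewrite -val_eqE /= label_predE -{1}(ltn_predK (label_gt1 l)).
    by rewrite gtn_eqF.
  have b0E : Gd_set b0 = Gd_set a :\ label_pred l.
    rewrite /Gd_set /= setDUl; congr (_ :|: _); apply/esym/setDidPl.
    rewrite disjoints1 inE; apply/eqP => e.
    by have := Gd_baseE pa; rewrite -e ltnn andbF.
  have pA : label_pred l \in Gd_set a by rewrite label_pred_set.
  rewrite (_ : [set _ | _] = [set b0]) ?cards1 //; apply/setP => b.
  rewrite !inE Gd_edgeP; apply/andP/eqP => [[_]|->].
    case/orP=> h; first by case/and3P: h; rewrite pa.
    have [nb _] := Gd_stepP h; case/and3P: h => _ _ /eqP ea.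
    by apply: Gd_set_inj; rewrite b0E ea setUC setU1K.
  split.
    apply/eqP => /(congr1 (@Gd_set D d)) /setP /(_ (label_pred l)).
    by rewrite b0E setD11 pA.
  apply/orP; right; apply/and3P; split.
  - by rewrite b0E in_setD1 lp la.
  - by rewrite /= setD11.
  - by rewrite b0E setUC setD1K.
pose b0 := GdVertex sub0.
have b0E : Gd_set b0 = Gd_set a :|: [set label_pred l].
  by rewrite /Gd_set /= setUCA setUC.
rewrite (_ : [set _ | _] = [set b0]) ?cards1 //; apply/setP => b.
rewrite !inE Gd_edgeP; apply/andP/eqP => [[_]|->].
  case/orP=> h.
    by case/and3P: h => _ _ /eqP eb; apply: Gd_set_inj; rewrite b0E.
  by have [_] := Gd_stepP h; rewrite label_pred_set // (negPf pa).
split; last by apply/orP; left; apply/and3P; split=> //; rewrite b0E.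
apply/eqP => /(congr1 (@Gd_set D d)) /setP /(_ (label_pred l)).
by rewrite b0E in_setU set11 orbT label_pred_set // (negPf pa).
Qed.

Definition Gd (D : nat) (d : 'I_D.+1) : edge_complete_graph D :=
  EdgeCompleteGraph (@Gd_edge_complete D d).

(* [elt a j] is a(j), the j-th smallest element of a, for 1 <= j <= |a|: the
   enumeration of a set of ordinals is increasing. *)
Definition elt (D : nat) (a : {set 'I_D.+1}) (j : nat) : nat :=
  nth 0%N [seq val k | k <- enum a] j.-1.

Definition c_star (R : realType) (D : nat) (lambda : R) (mu : nat -> R)
    (a : {set 'I_D.+1}) : R :=
  (-1) ^+ #|a|.-1 *
  \prod_(1 <= j < #|a|) \prod_((elt a j).+1 <= l < (elt a j.+1).+1)
    ((mu l - lambda) / (mu l - mu (elt a j))).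

Definition alpha_star (R : realType) (D : nat) (lambda : R) (mu : nat -> R)
    (a : {set 'I_D.+1}) : {ffun label D -> R[i]} :=
  [ffun l : label D =>
    (if (l <= elt a 1)%N then 1
     else if [pick j : 'I_#|a| | (0 < j)%N && (elt a j < l <= elt a j.+1)%N]
          is Some j then rho lambda mu (elt a j)
     else rho lambda mu (elt a #|a|))%:C].

Definition beta_star (R : realType) (D : nat) (lambda : R) (mu : nat -> R)
    (a : {set 'I_D.+1}) : R :=
  rho lambda mu (elt a #|a|).

(* Main.v *)
Require Import Defs.
From HB Require Import structures.
From mathcomp Require Import all_boot all_order all_algebra.
From mathcomp Require Import reals.
From mathcomp Require Import complex.
From mathcomp Require Import ring zify.

(** The proof rests on one change of variables.  For a set A of indices let
    rate A k be mu_x, where x is the largest element of A below k, and lambda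
    if A has no element below k; it obeys the recursion rate A (k+1) = mu_k
    when k is in A, and rate A (k+1) = rate A k otherwise.  Then the coordinates
    of the point attached to A are alpha(k) = lambda / rate A k, also at the
    two ends: rate A 1 = lambda gives the value 1 that the term mu_1 alpha(2)
    hides in its denominator, and rate A (D+1) = mu_d gives beta
    ([alpha_starE], [coord_starE]).  In these terms every constraint of the
    harmonic system becomes elementary.

    - The j-th term of p is mu_j rate(j) / rate(j+1), which is rate(j) if j is
      in A, and mu_j otherwise; in both cases it equals
      mu_j + rate(j) - rate(j+1).  So the sum telescopes ([rate_balance]) and
      p = lambda + sum_j mu_j = 1.
    - If l is not in A, then rate(l+1) = rate(l), and the l-th term of p is
      exactly mu_l: thus p_l = p, which settles the loops.
    - If l is in A, then C(l) = mu_l - rate(l).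
    - An edge with label l adds the element l-1 to A, which changes the rate
      at l only ([rate_insert]); the two rates at l have product
      rate(l-1) mu_(l-1), which is the conjugacy relation.
    - The double product in c* runs over the l between the least element of A
      and d, and its denominators are mu_l - rate(l).  For the remaining
      small l the rate is lambda and the factor
      (mu_l - lambda) / (mu_l - rate(l)) is 1, so the product can be taken over
      all of 1..d ([c_starE]).  Adding l-1 therefore replaces one factor and
      flips the sign, which is the required ratio of constants.

    The rates are positive, so the points have nonzero coordinates.  The
    constants are finite and nonzero, and different sets give different points,
    because rate A k is never equal to mu_l for l >= k ([mu_sub_rate_neq0]):
    this is where stability and the distinctness of the mu_j enter. *)

Set Implicit Arguments.
Unset Strict Implicit.
Unset Printing Implicit Defensive.

Import Order.TTheory GRing.Theory Num.Theory.
Local Open Scope ring_scope.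
Local Open Scope complex_scope.

(** * Auxiliary facts *)

Lemma ratio_of_cross_opp (F : fieldType) (x y u v : F) :
  y != 0 -> u != 0 -> x * u = - (y * v) -> x / y = - (v / u).
Proof.
move=> y0 u0 E; rewrite -[x](mulfK u0) E.
by field; rewrite y0 u0.
Qed.

Lemma label_bound (D : nat) (l : label D) : (0 < l <= D)%N.
Proof. by rewrite (ltnW (label_gt1 l)) -ltnS ltn_ord. Qed.

Lemma big_label (R : nmodType) (D : nat) (F : nat -> R) :
  \sum_(l : label D) F l = \sum_(2 <= j < D.+1) F j.
Proof.
rewrite big_geq_mkord /=; symmetry.
pose h (k : 'I_D.+1) : option (label D) := insub k.
rewrite (reindex_omap (@label_ord D) h).
  by apply: eq_bigl => l; rewrite /h valK eqxx andbT label_gt1.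
by move=> k k1; rewrite /h insubT.
Qed.

(** * The rate sequence of a set of indices *)

Section Rate.

Variables (R : fieldType) (lambda : R) (mu : nat -> R).

(** The value of mu at the predecessor of k in s, lambda playing the part of
    mu below the least element of s. *)
Fixpoint rate (s : seq nat) (k : nat) : R :=
  if k is j.+1 then if j \in s then mu j else rate s j else lambda.

(** Simplification would unfold the rates at numerals too. *)
Lemma rateS s k : rate s k.+1 = if k \in s then mu k else rate s k.
Proof. by []. Qed.

Lemma rate1 s : 0%N \notin s -> rate s 1 = lambda.
Proof. by rewrite rateS => /negPf ->. Qed.

Lemma rate_below s k : {in s, forall y, (k <= y)%N} -> rate s k = lambda.
Proof.
elim: k => // k IHk ge_k; rewrite rateS ifN; last first.
  by apply/negP => /ge_k; rewrite ltnn.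
by apply: IHk => y /ge_k /ltnW.
Qed.

Lemma rate_pred s x k : x \in s -> (x < k)%N ->
  {in s, forall y, (x < y)%N -> (k <= y)%N} -> rate s k = mu x.
Proof.
move=> xs; elim: k => // k IHk; rewrite ltnS leq_eqVlt rateS.
case/predU1P => [<- _|ltxk gap]; first by rewrite xs.
rewrite ifN; last by apply/negP => ks; have := gap _ ks ltxk; rewrite ltnn.
by apply: IHk => // y ys ltxy; apply/ltnW/gap.
Qed.

Lemma rateP s k :
  rate s k = lambda \/ exists x, [/\ x \in s, (x < k)%N & rate s k = mu x].
Proof.
elim: k => [|k IHk] /=; first by left.
case: ifP => [ks|_]; first by right; exists k.
by case: IHk => [|[x [xs ltxk E]]]; [left | right; exists x; rewrite ltnW].
Qed.

(** The predecessor of k in s changes only if x is inserted between it and k;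
    since x+1 is already in s, this leaves k = x+1 alone. *)
Lemma rate_insert s t x k : t =i x :: s -> x.+1 \in s -> k != x.+1 ->
  rate t k = rate s k.
Proof.
move=> tE xs; elim: k => // k IHk; rewrite eqSS /= tE in_cons => /negPf nkx.
rewrite nkx /=; case: ifP => // ks; apply: IHk.
by apply: contraFN ks => /eqP ->.
Qed.

(** The conjugacy relation in terms of rates: the rate at x+1 is that at x
    before x is inserted and mu_x afterwards. *)
Lemma rate_insert_mul s t x : t =i x :: s -> x.+1 \in s -> x \notin s ->
  rate s x.+1 * rate t x.+1 = rate s x * mu x.
Proof.
by move=> tE xs /negPf nxs; rewrite !rateS tE mem_head nxs.
Qed.

(** Telescoping: each term of the sum is mu_j + rate(j) - rate(j+1), whether
    or not j is in s. *)
Lemma rate_balance s n : 0%N \notin s -> (forall k, rate s k != 0) ->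
  rate s n.+1 + \sum_(1 <= j < n.+1) mu j * (rate s j / rate s j.+1)
  = lambda + \sum_(1 <= j < n.+1) mu j.
Proof.
move=> s0 nz; elim: n => [|n IHn]; first by rewrite !big_nil rate1.
rewrite !(big_nat_recr n.+1) //= addrA [RHS]addrA -IHn -!rateS.
rewrite ![_ + \sum_(_ <= j < _) _]addrC -!addrA; congr (_ + _).
have := nz n.+2; rewrite [rate s n.+2]rateS; case: ifP => _ ?.
  by rewrite mulrCA divff // mulr1 addrC.
by rewrite divff // mulr1.
Qed.

(** The constant c* up to sign, by [c_starE] below. *)
Definition rate_prod (s : seq nat) (n : nat) : R :=
  \prod_(1 <= l < n.+1) ((mu l - lambda) / (mu l - rate s l)).

Lemma rate_prod_insert s t x n : t =i x :: s -> x.+1 \in s -> (x < n)%N ->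
  mu x.+1 - rate s x.+1 != 0 -> mu x.+1 - rate t x.+1 != 0 ->
  rate_prod t n * (mu x.+1 - rate t x.+1) =
  rate_prod s n * (mu x.+1 - rate s x.+1).
Proof.
move=> tE xs ltxn nzs nzt.
have xn : x.+1 \in index_iota 1 n.+1 by rewrite mem_index_iota.
rewrite /rate_prod !(bigD1_seq x.+1) ?iota_uniq //=.
rewrite [LHS]mulrAC [RHS]mulrAC !divfK //; congr (_ * _).
by apply: eq_bigr => l nl; rewrite (rate_insert tE xs nl).
Qed.

End Rate.

(** * Increasing enumeration of a set of ordinals *)

Section Enumeration.

Variable D : nat.
Implicit Types (A : {set 'I_D.+1}).

Definition elts A : seq nat := [seq val k | k <- enum A].

Lemma eltE A j : elt A j = nth 0%N (elts A) j.-1.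
Proof. by []. Qed.

Lemma size_elts A : size (elts A) = #|A|.
Proof. by rewrite size_map -cardE. Qed.

Lemma mem_elts A (k : 'I_D.+1) : (nat_of_ord k \in elts A) = (k \in A).
Proof. by rewrite /elts (mem_map val_inj) mem_enum. Qed.

Lemma eltsP A (k : nat) :
  reflect (exists2 x : 'I_D.+1, x \in A & k = x) (k \in elts A).
Proof.
apply: (iffP mapP) => [[x xA ->]|[x xA ->]]; exists x => //.
  by rewrite mem_enum in xA.
by rewrite mem_enum.
Qed.

Lemma sorted_elts A : sorted ltn (elts A).
Proof.
rewrite /elts sorted_map /enum_mem; apply: sorted_filter.
  by move=> y x z; apply: ltn_trans.
rewrite -enumT -(sorted_map (e' := ltn)) val_enum_ord.
exact: iota_ltn_sorted.
Qed.

Lemma mem_elt A j : (0 < j <= #|A|)%N -> elt A j \in elts A.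
Proof. by case: j => // j ltj; rewrite eltE mem_nth // size_elts. Qed.

Lemma eltP A k : k \in elts A -> exists2 j, (0 < j <= #|A|)%N & elt A j = k.
Proof.
case/(nthP 0%N) => j; rewrite size_elts => ltj <-; by exists j.+1.
Qed.

Lemma ltn_elt A i j : (0 < i)%N -> (i < j <= #|A|)%N -> (elt A i < elt A j)%N.
Proof.
case: i j => // i [|j] // _ /andP[ltij lej]; rewrite !eltE /=.
apply: (sorted_ltn_nth ltn_trans 0%N (sorted_elts A)) => //.
  by rewrite inE size_elts (ltn_trans _ lej).
by rewrite inE size_elts.
Qed.

Lemma leq_elt A i j : (0 < i)%N -> (i <= j <= #|A|)%N -> (elt A i <= elt A j)%N.
Proof.
move=> i0; rewrite leq_eqVlt => /andP[/predU1P[->//|ltij] lej].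
by apply/ltnW/ltn_elt => //; rewrite ltij.
Qed.

Lemma elt_gap A j y : (0 < j)%N -> y \in elts A -> (elt A j < y)%N ->
  (elt A j.+1 <= y)%N.
Proof.
move=> j0 /eltP[i /andP[i0 lei] <-] ltji.
(* Past the last element, elt takes the default value 0. *)
have [leAj|ltjA] := leqP #|A| j; first by rewrite eltE nth_default ?size_elts.
apply: leq_elt => //; rewrite lei andbT ltnNge; apply/negP => leij.
have := leq_elt i0 (introT andP (conj leij (ltnW ltjA))).
by rewrite leqNgt ltji.
Qed.

End Enumeration.

(** * The point and the constant attached to a set with maximum d *)

Section StarPoint.

Variables (R : realType) (D : nat) (lambda : R) (mu : nat -> R).
Hypothesis lambda_gt0 : 0 < lambda.
Hypothesis mu_gt_lambda : forall j : nat, (1 <= j <= D)%N -> lambda < mu j.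
Hypothesis mu_inj : forall i j : nat, (1 <= i <= D)%N -> (1 <= j <= D)%N ->
  i <> j -> mu i <> mu j.

Variables (A : {set 'I_D.+1}) (d : 'I_D.+1).
Hypothesis dA : d \in A.
Hypothesis Ad : forall k : 'I_D.+1, k \in A -> (0 < k <= d)%N.

Local Notation rA := (rate lambda mu (elts A)).

Lemma elts_bound k : k \in elts A -> (0 < k <= d)%N.
Proof. by case/eltsP => x /Ad xd ->. Qed.

Lemma elts_bound_D k : k \in elts A -> (0 < k <= D)%N.
Proof.
by move/elts_bound => /andP[-> lekd]; rewrite (leq_trans lekd) // -ltnS.
Qed.

Lemma card_star_gt0 : (0 < #|A|)%N.
Proof. by apply/card_gt0P; exists d. Qed.

Lemma elts0 : 0%N \notin elts A.
Proof. by apply/negP => /elts_bound. Qed.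

Lemma elt_last : elt A #|A| = d.
Proof.
have A0 := card_star_gt0.
apply/eqP; rewrite eqn_leq.
have /elts_bound /andP[_ ->] : elt A #|A| \in elts A.
  by apply: mem_elt; rewrite A0 leqnn.
have /eltP[j /andP[j0 leA] <-] : nat_of_ord d \in elts A by rewrite mem_elts.
by apply: leq_elt => //; rewrite leA leqnn.
Qed.

Lemma rate_gt0 k : 0 < rA k.
Proof.
have [->//|[x [/elts_bound_D xD _ ->]]] := rateP lambda mu (elts A) k.
exact: lt_trans lambda_gt0 (mu_gt_lambda xD).
Qed.

Lemma rate_neq0 k : rA k != 0.
Proof. by rewrite gt_eqF // rate_gt0. Qed.

(** The rate at k is lambda, which is smaller than mu_l, or mu_x for some
    x < k <= l. *)
Lemma mu_sub_rate_neq0 k l : (k <= l)%N -> (0 < l <= D)%N -> mu l - rA k != 0.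
Proof.
move=> lekl lD; rewrite subr_eq0.
have [->|[x [/elts_bound_D xD ltxk ->]]] := rateP lambda mu (elts A) k.
  by rewrite gt_eqF // mu_gt_lambda.
by apply/eqP/mu_inj => // lx; move: ltxk; rewrite -lx ltnNge lekl.
Qed.

Lemma rate_last k : (d < k)%N -> rA k = mu d.
Proof.
move=> ltdk; apply: rate_pred; rewrite ?mem_elts //.
by move=> y /elts_bound /andP[_ leyd]; rewrite ltnNge leyd.
Qed.

Lemma beta_starE : beta_star lambda mu A = lambda / mu d.
Proof. by rewrite /beta_star elt_last. Qed.

(** On the gap after the j-th element, unbounded when j = #|A|, the rate is
    constant. *)
Lemma rate_elt j k : (0 < j <= #|A|)%N -> (elt A j < k)%N ->
  ((j < #|A|)%N -> (k <= elt A j.+1)%N) -> rA k = mu (elt A j).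
Proof.
move=> jA ltk lek; case/andP: (jA) => j0.
rewrite leq_eqVlt => /predU1P[jE|/lek {}lek].
  by rewrite jE elt_last rate_last // -elt_last -jE.
apply: rate_pred => //; first exact: mem_elt.
by move=> y yA lty; apply: leq_trans lek (elt_gap j0 yA lty).
Qed.

Lemma rate_first k : (k <= elt A 1)%N -> rA k = lambda.
Proof.
move=> lek; apply: rate_below => y /eltP[j /andP[j0 leA] <-].
by apply: leq_trans lek (leq_elt _ _); rewrite ?j0.
Qed.

Lemma alpha_starE (l : label D) :
  alpha_star lambda mu A l = (lambda / rA l)%:C.
Proof.
rewrite ffunE; congr _%:C.
case: leqP => [le1|gt1]; first by rewrite rate_first // divff // gt_eqF.
case: pickP => [j /andP[j0 /andP[ltj lej]]|none].
  by rewrite /rho (@rate_elt j) // j0 ltnW.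
(* As no gap contains l and l is beyond the first element, l is beyond all
   the elements. *)
have {none} ltA j : (0 < j <= #|A|)%N -> (elt A j < l)%N.
  elim: j => // -[_ //|j] IHj ltj.
  have ltjl : (elt A j.+1 < l)%N.
    by apply: IHj; apply: ltnW.
  have := none (Ordinal (ltj : (j.+1 < #|A|)%N)).
  by rewrite /= ltjl /= ltnNge => ->.
have A0 := card_star_gt0.
by rewrite /rho (@rate_elt #|A|) ?ltnn // ?ltA // A0 leqnn.
Qed.

(** The convention alpha(D+1) = beta extends the formula for alpha, as d is the
    last element of A. *)
Lemma coord_starE k : (1 < k <= D.+1)%N ->
  Defs.coord (lambda / mu d)%:C (alpha_star lambda mu A) k = (lambda / rA k)%:C.
Proof.
case/andP=> gt1 leD; rewrite /Defs.coord; case: pickP => [l /eqP <-|none].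
  exact: alpha_starE.
move: leD; rewrite leq_eqVlt => /predU1P[->|ltD]; first by rewrite rate_last.
by have := none (@Label D (Ordinal ltD) gt1); rewrite /= eqxx.
Qed.

Lemma prod_elt_gaps (F : nat -> R) n : (n < #|A|)%N ->
  \prod_(1 <= j < n.+1) \prod_((elt A j).+1 <= l < (elt A j.+1).+1) F l =
  \prod_((elt A 1).+1 <= l < (elt A n.+1).+1) F l.
Proof.
elim: n => [|n IHn] ltn; first by rewrite !big_geq.
rewrite big_nat_recr //= IHn; last exact: ltnW.
by rewrite -big_cat_nat ?ltnS ?leq_elt ?(ltnW ltn) ?leqnSn.
Qed.

(** The factors with l at most the least element of A are 1, so the product
    may start at 1 instead; its range then does not depend on A, and the
    constants of two sets can be compared factor by factor. *)
Lemma c_starE : c_star lambda mu A =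
  (-1) ^+ #|A|.-1 * rate_prod lambda mu (elts A) d.
Proof.
have A0 := card_star_gt0.
rewrite /c_star; congr (_ * _); rewrite /rate_prod.
have le1d : (elt A 1 <= d)%N by rewrite -elt_last leq_elt // A0 leqnn.
rewrite [RHS](@big_cat_nat _ _ _ (elt A 1).+1) //=.
rewrite [X in _ = X * _]big_nat [X in _ = X * _]big1 ?mul1r; last first.
  move=> l /andP[l0]; rewrite ltnS => le1.
  rewrite rate_first // divff // subr_eq0 gt_eqF // mu_gt_lambda // l0.
  by rewrite -ltnS (leq_ltn_trans (leq_trans le1 le1d)).
rewrite -[in RHS]elt_last -(prednK A0) -prod_elt_gaps ?prednK //.
apply: eq_big_nat => j /andP[j0 ltj]; apply: eq_big_nat => l /andP[ltl lel].
by rewrite (@rate_elt j) // j0 ltnW.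
Qed.

Lemma rate_prod_neq0 n : (n <= D)%N -> rate_prod lambda mu (elts A) n != 0.
Proof.
move=> leD; rewrite /rate_prod prodf_seq_neq0.
apply/allP => l; rewrite mem_index_iota => /andP[l0 ltl] /=.
have lD : (0 < l <= D)%N by rewrite l0 (leq_trans _ leD).
rewrite mulf_neq0 ?invr_neq0 ?mu_sub_rate_neq0 //.
by rewrite subr_eq0 gt_eqF ?mu_gt_lambda.
Qed.

Lemma c_star_neq0 : c_star lambda mu A != 0.
Proof. by rewrite c_starE mulf_neq0 ?signr_eq0 // rate_prod_neq0 // -ltnS. Qed.

Hypothesis mass1 : lambda + \sum_(1 <= j < D.+1) mu j = 1.

Local Notation beta := ((lambda / mu d)%:C).
Local Notation alpha := (alpha_star lambda mu A).

Lemma star_ratio (l : label D) :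
  Defs.coord beta alpha l.+1 / alpha l = (rA l / rA l.+1)%:C.
Proof.
have /andP[l0 lD] := label_bound l.
rewrite coord_starE ?ltnS ?l0 // alpha_starE -fmorph_div; congr _%:C.
by field; rewrite !rate_neq0 gt_eqF.
Qed.

Lemma star_nonzero : nonzero_pt beta alpha.
Proof.
have nz k : lambda / rA k != 0.
  by rewrite mulf_neq0 ?invr_neq0 ?rate_neq0 // gt_eqF.
split; first by rewrite fmorph_eq0 -(rate_last (ltnSn d)).
by move=> l; rewrite alpha_starE fmorph_eq0.
Qed.

Lemma star_inH : inH lambda mu beta alpha.
Proof.
have lam0 : lambda != 0 by rewrite gt_eqF.
have D1 : (0 < D)%N.
  by have /andP[] := elts_bound_D (etrans (mem_elts A d) dA); lia.
split; first exact: star_nonzero.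
rewrite /charp; under eq_bigr => l _ do rewrite star_ratio -rmorphM.
rewrite (big_label D (fun j => (mu j * (rA j / rA j.+1))%:C)) -rmorph_sum /=.
rewrite coord_starE // -!(fmorphV, rmorphM, rmorphD) -[RHS]/(1%:C); congr _%:C.
(* The term mu_1 alpha(2) is the one with index 1 of the telescoping sum,
   because rate(1) = lambda; and lambda / beta is rate(D+1). *)
have balance := rate_balance D elts0 rate_neq0.
rewrite mass1 big_ltn // in balance; rewrite -[in RHS]balance.
rewrite rate1 ?elts0 // (rate_last (ltn_ord d)) addrA; congr (_ + _ * _ + _).
by rewrite invf_div mulrCA divff // mulr1.
Qed.

(** The l-th term of p is mu_l, because the rates at l and l+1 agree. *)
Lemma star_inH_l (l : label D) : label_ord l \notin A ->
  inH lambda mu beta alpha -> inH_l lambda mu l beta alpha.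
Proof.
move=> lA [nz H1]; split=> //; rewrite -H1 /charp /charp_l.
rewrite [in RHS](bigD1 l) //= addrA star_ratio rateS mem_elts (negPf lA).
by rewrite divff ?rate_neq0 // mulr1.
Qed.

Lemma star_Ccoef (l : label D) : label_ord l \in A ->
  Ccoef mu l beta alpha = (mu l - rA l)%:C.
Proof.
move=> lA; rewrite /Ccoef star_ratio rateS mem_elts lA rmorphB /= -rmorphM.
rewrite mulrC divfK // gt_eqF // (lt_trans lambda_gt0) //.
by rewrite mu_gt_lambda ?label_bound.
Qed.

(** The case l = 2 falls under the general formula because its missing factor
    alpha(1) would be lambda / rate(1) = 1. *)
Lemma star_conjugate_value (l : label D) : conjugate_value mu l beta alpha =
  (lambda * rA l * mu l / (rA l.-1 * rA l.+1 * mu l.-1))%:C.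
Proof.
have /andP[l0 lD] := label_bound l; have l1 := label_gt1 l.
have lam0 : lambda != 0 by rewrite gt_eqF.
have m0 : mu l.-1 != 0.
  by rewrite gt_eqF // (lt_trans lambda_gt0) // mu_gt_lambda //; lia.
rewrite /conjugate_value; case: eqP => [l2|/eqP l2].
  rewrite l2 -[2.-1]/1%N in lD m0 *.
  rewrite !coord_starE ?ltnS ?(ltnW lD) //.
  rewrite rate1 ?elts0 // -!(fmorphV, rmorphM); congr _%:C.
  by field; rewrite !rate_neq0 m0 lam0.
rewrite alpha_starE !coord_starE; [|lia..].
rewrite -!(fmorphV, rmorphM); congr _%:C.
by field; rewrite !rate_neq0 m0 lam0.
Qed.

End StarPoint.

(** * Vertices and edges of the graph *)

Section Vertices.

Variables (R : realType) (D : nat) (lambda : R) (mu : nat -> R).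
Hypothesis lambda_gt0 : 0 < lambda.
Hypothesis mu_gt_lambda : forall j : nat, (1 <= j <= D)%N -> lambda < mu j.
Hypothesis mu_inj : forall i j : nat, (1 <= i <= D)%N -> (1 <= j <= D)%N ->
  i <> j -> mu i <> mu j.
Variable d : 'I_D.+1.
Hypothesis d_gt0 : (0 < d)%N.

Implicit Types a b : Gd_vertex d.

Local Notation r a := (rate lambda mu (elts (Gd_set a))).

Lemma mem_top a : d \in Gd_set a.
Proof. exact: setU11. Qed.

Lemma Gd_set_bound a (k : 'I_D.+1) : k \in Gd_set a -> (0 < k <= d)%N.
Proof.
case/setU1P => [->|/Gd_baseE /andP[-> /ltnW //]].
by rewrite d_gt0 leqnn.
Qed.

(** The points differ in coordinate k+1: there the rate of the first set is
    mu_k, a value that the rate of the second, still equal to that at k, cannot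
    take.  As k is not the common maximum d, k+1 is a label. *)
Lemma alpha_star_neq a b (k : 'I_D.+1) :
  k \in Gd_set a -> k \notin Gd_set b ->
  alpha_star lambda mu (Gd_set a) <> alpha_star lambda mu (Gd_set b).
Proof.
move=> ka kb; have /andP[k0 lekd] := Gd_set_bound ka.
have ltkd : (k < d)%N.
  rewrite ltn_neqAle lekd andbT; apply: contraNneq kb => /val_inj ->.
  exact: mem_top.
have kD : (0 < k <= D)%N by rewrite k0 -ltnS ltn_ord.
pose l := @Label D (Ordinal (leq_ltn_trans ltkd (ltn_ord d))) k0.
move=> /ffunP /(_ l).
rewrite !(alpha_starE mu lambda_gt0 (mem_top _) (@Gd_set_bound _)) /=.
rewrite !mem_elts ka (negPf kb) => -[/(mulfI (lt0r_neq0 lambda_gt0))].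
move=> /invr_inj /eqP; rewrite -subr_eq0; apply/negP.
exact: (mu_sub_rate_neq0 mu_gt_lambda mu_inj (@Gd_set_bound b)).
Qed.

Lemma alpha_star_inj a b : a != b ->
  alpha_star lambda mu (Gd_set a) <> alpha_star lambda mu (Gd_set b).
Proof.
move=> nab.
have : Gd_set a != Gd_set b by apply: contraNneq nab => /Gd_set_inj ->.
rewrite eqEsubset negb_and => /orP[] /subsetPn[k kx ky].
  exact: alpha_star_neq kx ky.
by apply/nesym; apply: alpha_star_neq kx ky.
Qed.

Section Step.

Variables (a b : Gd_vertex d) (l : label D).
Hypothesis step : Gd_step a b l.

Lemma step_mem : (label_ord l \in Gd_set a) * (label_ord l \in Gd_set b).
Proof.
by case/and3P: step => la _ /eqP bE; split=> //; rewrite bE in_setU la.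
Qed.

Lemma step_elts_mem : l.-1.+1 \in elts (Gd_set a).
Proof. by rewrite (ltn_predK (label_gt1 l)) mem_elts step_mem. Qed.

Lemma step_elts_notin : l.-1 \notin elts (Gd_set a).
Proof. by rewrite -label_predE mem_elts; case: (Gd_stepP step). Qed.

Lemma step_elts : elts (Gd_set b) =i l.-1 :: elts (Gd_set a).
Proof.
case/and3P: step => _ _ /eqP bE k; rewrite in_cons -label_predE.
apply/eltsP/predU1P => [[x]|[->|/eltsP[x xa ->]]].
- rewrite bE => /setUP[xa ->|/set1P -> ->]; last by left.
  by right; rewrite mem_elts.
- by exists (label_pred l); rewrite // bE in_setU set11 orbT.
- by exists x; rewrite // bE in_setU xa.
Qed.

Lemma step_rate k : k != l :> nat -> r b k = r a k.
Proof.
move=> nkl; apply: rate_insert step_elts step_elts_mem _.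
by rewrite (ltn_predK (label_gt1 l)).
Qed.

Lemma step_rate_mul : r a l * r b l = r a l.-1 * mu l.-1.
Proof.
rewrite -{1 2}(ltn_predK (label_gt1 l)).
exact: rate_insert_mul step_elts step_elts_mem step_elts_notin.
Qed.

Lemma step_alpha (k : label D) : k != l ->
  alpha_star lambda mu (Gd_set b) k = alpha_star lambda mu (Gd_set a) k.
Proof.
move=> nkl; rewrite !(alpha_starE mu lambda_gt0 (mem_top _) (@Gd_set_bound _)).
by rewrite step_rate.
Qed.

(** Both directions are needed because conjugacy is stated for ordered pairs
    while an edge may be traversed either way. *)
Lemma step_conjugate :
  alpha_star lambda mu (Gd_set b) l =
    conjugate_value mu l (lambda / mu d)%:C (alpha_star lambda mu (Gd_set a)) /\
  alpha_star lambda mu (Gd_set a) l =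
    conjugate_value mu l (lambda / mu d)%:C (alpha_star lambda mu (Gd_set b)).
Proof.
have nz (c : Gd_vertex d) k : r c k != 0.
  exact: (rate_neq0 lambda_gt0 mu_gt_lambda (@Gd_set_bound c)).
rewrite !(star_conjugate_value lambda_gt0 mu_gt_lambda
            (mem_top _) (@Gd_set_bound _)).
rewrite !(alpha_starE mu lambda_gt0 (mem_top _) (@Gd_set_bound _)).
have rateS_l : (r a l.+1 = mu l) * (r b l.+1 = mu l).
  by rewrite !rateS !mem_elts !step_mem.
rewrite (@step_rate l.-1) ?rateS_l; last by have := label_gt1 l; lia.
have -> : mu l.-1 = r a l * r b l / r a l.-1.
  by rewrite step_rate_mul mulrAC divff // mul1r.
have nz_mul : mu l != 0 by rewrite -rateS_l.1.
by split; congr _%:C; field; rewrite !nz nz_mul.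
Qed.

(** Only the factor with index l of the product changes, and the cardinality
    goes up by one. *)
Lemma step_c_star :
  c_star lambda mu (Gd_set b) * (mu l - r b l) =
  - (c_star lambda mu (Gd_set a) * (mu l - r a l)).
Proof.
have lE := ltn_predK (label_gt1 l).
have lD := label_bound l.
have nz (c : Gd_vertex d) : mu l.-1.+1 - r c l.-1.+1 != 0.
  rewrite lE.
  exact: (mu_sub_rate_neq0 mu_gt_lambda mu_inj (@Gd_set_bound c)).
have cardE : #|Gd_set b| = #|Gd_set a|.+1.
  case/and3P: step => _ _ /eqP ->; rewrite setUC cardsU1.
  by case: (Gd_stepP step) => ->.
have ld : (l.-1 < d)%N by rewrite lE; case/andP: (Gd_set_bound step_mem.1).
have := rate_prod_insert step_elts step_elts_mem ld (nz a) (nz b).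
rewrite lE => prodE.
rewrite !(c_starE mu_gt_lambda (mem_top _) (@Gd_set_bound _)) cardE /=.
rewrite -!mulrA prodE -{1}(prednK (card_star_gt0 (mem_top a))) exprS.
by rewrite mulN1r mulNr.
Qed.

End Step.

End Vertices.

(** * The harmonic system *)

Theorem proposition6p3 (R : realType) (D : nat) (lambda : R) (mu : nat -> R)
    (hD : (2 <= D)%N)
    (hlambda : 0 < lambda)
    (hmu : forall j : nat, (1 <= j <= D)%N -> 0 < mu j)
    (hsum : lambda + \sum_(1 <= j < D.+1) mu j = 1)
    (hstable : forall j : nat, (1 <= j <= D)%N -> lambda < mu j)
    (hdistinct : forall i j : nat, (1 <= i <= D)%N -> (1 <= j <= D)%N ->
       i <> j -> mu i <> mu j)
    (d : 'I_D.+1) (hd : (1 <= d)%N) :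
  exists beta : R[i],
    (forall a : Gd d, (beta_star lambda mu (Gd_set a))%:C = beta) /\
    solves_harmonic_system lambda mu beta
      (fun a : Gd d => alpha_star lambda mu (Gd_set a))
      (fun a : Gd d => (c_star lambda mu (Gd_set a))%:C).
Proof.
have bound (a : Gd_vertex d) := @Gd_set_bound D d hd a.
have inH (a : Gd_vertex d) :=
  star_inH hlambda hstable (mem_top a) (bound a) hsum.
have neq := alpha_star_inj hlambda hstable hdistinct hd.
exists (lambda / mu d)%:C; split=> [a|].
  by rewrite (beta_starE _ _ (mem_top a) (bound a)).
split=> [a|//|a b l nab /eqP|a b l nab /eqP|a l].
- split=> //; rewrite fmorph_eq0.
  exact: (c_star_neq0 hstable hdistinct (mem_top a) (bound a)).
- rewrite Gd_edgeP => /orP[] step; split=> //; try exact: neq.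
  + exact: (step_alpha mu hlambda hd step).
  + by case: (step_conjugate hlambda hstable hd step).
  + by move=> k nkl; rewrite (step_alpha mu hlambda hd step nkl).
  + by case: (step_conjugate hlambda hstable hd step).
- have c_neq0 (v : Gd_vertex d) : (c_star lambda mu (Gd_set v))%:C != 0.
    rewrite fmorph_eq0.
    exact: (c_star_neq0 hstable hdistinct (mem_top v) (bound v)).
  have C_neq0 (v : Gd_vertex d) :
      (mu l - rate lambda mu (elts (Gd_set v)) l)%:C != 0.
    rewrite fmorph_eq0.
    exact: (mu_sub_rate_neq0 hstable hdistinct (bound v) _ (label_bound l)).
  rewrite Gd_edgeP => /orP[] step.
    have [la lb] := step_mem step.
    rewrite !(star_Ccoef hlambda hstable (mem_top _) (bound _)) //.
    apply: ratio_of_cross_opp => //.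
    rewrite -!rmorphM -rmorphN; congr _%:C.
    by rewrite (step_c_star hstable hdistinct hd step) opprK.
  have [lb la] := step_mem step.
  rewrite !(star_Ccoef hlambda hstable (mem_top _) (bound _)) //.
  apply: ratio_of_cross_opp => //.
  rewrite -!rmorphM -rmorphN; congr _%:C.
  exact: (step_c_star hstable hdistinct hd step).
- rewrite inE => la.
  exact: (star_inH_l hlambda hstable (mem_top a) (bound a) la (inH a)).
Qed.
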